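(* Let $\alpha,\beta\in\mathbb{R}$. The double inequality $$\alpha C(a,b)+(1-\alpha)T(a,b)<S(a,b)<\beta C(a,b)+(1-\beta)T(a,b)$$ holds for all real $a,b>0$ with $a\ne b$ if and only if $\alpha\le \frac{\pi-2\sqrt{2}}{\sqrt{2}\,\pi-2\sqrt{2}}$ and $\beta\ge \frac{1}{4}$.
   Context: For real numbers $a,b>0$ with $a\neq b$: the contra-harmonic mean is $C(a,b)=\frac{a^2+b^2}{a+b}$; the root-square mean is $S(a,b)=\sqrt{\frac{a^2+b^2}{2}}$; the second Seiffert mean is $T(a,b)=\frac{a-b}{2\arctan\left(\frac{a-b}{a+b}\right)}$. *)

(* Defs.v *)
From Stdlib Require Import Reals.
Open Scope R_scope.

Definition contraharmonic_mean (a b : R) : R := (a ^ 2 + b ^ 2) / (a + b).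

Definition root_square_mean (a b : R) : R := sqrt ((a ^ 2 + b ^ 2) / 2).

(** Meaningful only for [a <> b]: on the diagonal this is the total-division
    junk value [0 / 0], not the continuous extension [a]. *)
Definition second_seiffert_mean (a b : R) : R :=
  (a - b) / (2 * atan ((a - b) / (a + b))).

(* Main.v *)
Require Import Defs.
From Stdlib Require Import Reals.
From Stdlib Require Import Lra.
From Coquelicot Require Import Coquelicot.
Open Scope R_scope.

(** Put [a = u (1 + tan x)] and [b = u (1 - tan x)] with [u > 0]; up to
    swapping [a] and [b], every pair of distinct positive numbers arises from
    exactly one [x] in [(0, PI/4)].  The three means become
    [C = u / cos^2 x], [S = u / cos x] and [T = u tan x / x], so that
    [S - (mu C + (1 - mu) T)] is a positive multiple of
    [gap mu x = cos x (x - sin x) - mu (x - sin x cos x)].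
    The theorem thus asks for which [mu] the function [gap mu] is positive,
    respectively negative, on all of [(0, PI/4)].

    Everything follows from [gap mu 0 = 0] and from the factorisation
    [gap' mu = sin^2 x * slope mu x], where
    [slope mu x = 1 - 2 mu + cos x / (1 + cos x) - x / sin x]
    is strictly decreasing ([slope_decreasing]) and tends to [1/2 - 2 mu]
    at [0] ([slope_upper], [slope_lower]).
    - [gap mu] can only increase first and decrease afterwards, so it is
      positive inside the interval as soon as it is nonnegative at [PI/4]
      ([gap_pos_iff]); that endpoint condition is linear in [mu] and gives the
      first constant ([gap_PI4_nonneg_iff]).
    - [gap mu] is negative on the interval iff it does not increase at the
      start, that is iff [1/2 - 2 mu <= 0] ([gap_neg_iff]). *)

(** * The gap function and its derivative *)

Definition gap (mu x : R) : R :=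
  cos x * (x - sin x) - mu * (x - sin x * cos x).

(** The derivative of [gap mu], divided by [sin x ^ 2]. *)
Definition slope (mu x : R) : R :=
  1 - 2 * mu + cos x / (1 + cos x) - x / sin x.

Lemma sin_sqr (x : R) : sin x * sin x = 1 - cos x * cos x.
Proof. generalize (sin2_cos2 x); unfold Rsqr; lra. Qed.

Lemma gap_0 (mu : R) : gap mu 0 = 0.
Proof. unfold gap; rewrite sin_0, cos_0; ring. Qed.

Lemma gap_derivative (mu x : R) :
  derivable_pt_lim (gap mu) x
    ((1 - 2 * mu) * sin x ^ 2 + cos x * (1 - cos x) - x * sin x).
Proof.
  apply is_derive_Reals; unfold gap; auto_derive; [easy|].
  assert (Hs := sin_sqr x); ring [Hs].
Qed.

Lemma gap_continuous (mu x : R) : continuity_pt (gap mu) x.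
Proof.
  apply derivable_continuous_pt; eexists; apply gap_derivative.
Qed.

Lemma acute_pos (x : R) : 0 < x < PI / 2 -> 0 < sin x /\ 0 < cos x < 1.
Proof.
  intros Hx; assert (HPI := PI_RGT_0).
  split; [apply sin_gt_0; lra|]; split; [apply cos_gt_0; lra|].
  rewrite <- cos_0; apply cos_decreasing_1; lra.
Qed.

(** The factorisation uses [cos x (1 - cos x) / sin^2 x = cos x / (1 + cos x)]. *)
Lemma gap_mvt (mu x y : R) : 0 <= x < y -> y < PI / 2 ->
  exists c, x < c < y /\
    gap mu y - gap mu x = sin c ^ 2 * slope mu c * (y - x).
Proof.
  intros Hxy Hy.
  destruct (MVT_cor2 (gap mu) _ x y (proj2 Hxy)
              (fun c _ => gap_derivative mu c)) as [c [E Hc]].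
  exists c; split; [exact Hc|]; rewrite E; f_equal.
  destruct (acute_pos c) as [Hs Hcos]; [lra|].
  unfold slope.
  replace (cos c / (1 + cos c)) with (cos c * (1 - cos c) / sin c ^ 2).
  - field; lra.
  - replace (sin c ^ 2) with ((1 - cos c) * (1 + cos c))
      by (simpl; rewrite Rmult_1_r, sin_sqr; ring).
    field; lra.
Qed.

(** * Monotonicity of the slope and its limit at zero *)

(** [tan x > x], cleared of denominators: [sin x - x cos x] vanishes at [0]
    and has derivative [x sin x]. *)
Lemma x_cos_lt_sin (x : R) : 0 < x < PI / 2 -> x * cos x < sin x.
Proof.
  intros Hx.
  destruct (MVT_cor2 (fun y => sin y - y * cos y) (fun y => y * sin y) 0 x)
    as [c [E Hc]]; [lra| |].
  { intros c _; apply is_derive_Reals; auto_derive; [easy | ring]. }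
  destruct (acute_pos c) as [Hs _]; [lra|].
  rewrite sin_0 in E.
  assert (0 < c * sin c * (x - 0)) by (repeat apply Rmult_lt_0_compat; lra).
  lra.
Qed.

Lemma slope_decreasing (mu x y : R) : 0 < x < y -> y < PI / 2 ->
  slope mu y < slope mu x.
Proof.
  intros Hxy Hy.
  destruct (MVT_cor2 (slope mu)
              (fun z => - (sin z / (1 + cos z) ^ 2)
                        - (sin z - z * cos z) / sin z ^ 2) x y)
    as [c [E Hc]]; [lra| |].
  { intros c Hc; destruct (acute_pos c) as [Hs Hcos]; [lra|].
    apply is_derive_Reals; unfold slope; auto_derive.
    - split; [lra | split; [lra | easy]].
    - field; lra. }
  destruct (acute_pos c) as [Hs Hcos]; [lra|].
  assert (Ht := x_cos_lt_sin c ltac:(lra)).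
  assert (0 < sin c / (1 + cos c) ^ 2)
    by (apply Rdiv_lt_0_compat; [lra | apply pow_lt; lra]).
  assert (0 < (sin c - c * cos c) / sin c ^ 2)
    by (apply Rdiv_lt_0_compat; [lra | apply pow_lt; lra]).
  nra.
Qed.

Lemma slope_upper (mu x : R) : 0 < x < PI / 2 -> slope mu x < 1 / 2 - 2 * mu.
Proof.
  intros Hx; destruct (acute_pos x Hx) as [Hs Hcos].
  assert (H1 : cos x / (1 + cos x) < 1 / 2).
  { apply Rmult_lt_reg_r with (1 + cos x); [lra|].
    unfold Rdiv at 1; rewrite Rmult_assoc, Rinv_l; lra. }
  assert (H2 : 1 < x / sin x).
  { apply Rmult_lt_reg_r with (sin x); [lra|].
    unfold Rdiv; rewrite Rmult_assoc, Rinv_l; [|lra].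
    assert (Hlt := sin_lt_x x (proj1 Hx)); lra. }
  unfold slope; lra.
Qed.

(** Unlike [slope mu] itself, this lower bound is continuous at [0], where it
    takes the value [1/2 - 2 mu]. *)
Lemma slope_lower (mu x : R) : 0 < x < PI / 2 ->
  1 - 2 * mu + cos x / (1 + cos x) - / cos x < slope mu x.
Proof.
  intros Hx; destruct (acute_pos x Hx) as [Hs Hcos].
  assert (H : x / sin x < / cos x).
  { apply Rmult_lt_reg_r with (sin x * cos x); [nra|].
    replace (x / sin x * (sin x * cos x)) with (x * cos x) by (field; lra).
    replace (/ cos x * (sin x * cos x)) with (sin x) by (field; lra).
    now apply x_cos_lt_sin. }
  unfold slope; lra.
Qed.

(** * The sign of the gap on the interval *)

Lemma continuity_pt_neg_near (f : R -> R) (x : R) :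
  continuity_pt f x -> f x < 0 ->
  exists d, 0 < d /\ forall y, Rabs (y - x) < d -> f y < 0.
Proof.
  intros Hf Hneg.
  destruct (Hf (- f x)) as [d [Hd H]]; [lra|].
  exists d; split; [exact Hd|]; intros y Hy.
  destruct (Req_dec x y) as [<- | Hne]; [exact Hneg|].
  assert (Hfy : Rabs (f y - f x) < - f x).
  { apply (H y); split; [split; [exact I | exact Hne] | exact Hy]. }
  apply Rabs_def2 in Hfy; lra.
Qed.

Lemma gap_pos_iff (mu : R) :
  (forall x, 0 < x < PI / 4 -> 0 < gap mu x) <-> 0 <= gap mu (PI / 4).
Proof.
  assert (HPI := PI_RGT_0); split.
  - intros H; apply Rnot_lt_le; intros Hneg.
    destruct (continuity_pt_neg_near _ _ (gap_continuous mu (PI / 4)) Hneg)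
      as [d [Hd Hnear]].
    (* a point of the interval at distance less than [d] from its right end *)
    assert (Hmax := Rmax_l (PI / 8) (PI / 4 - d / 2)).
    assert (Hmax' := Rmax_r (PI / 8) (PI / 4 - d / 2)).
    assert (Hlt : Rmax (PI / 8) (PI / 4 - d / 2) < PI / 4)
      by (apply Rmax_lub_lt; lra).
    specialize (H (Rmax (PI / 8) (PI / 4 - d / 2)) ltac:(lra)).
    specialize (Hnear (Rmax (PI / 8) (PI / 4 - d / 2))).
    assert (gap mu (Rmax (PI / 8) (PI / 4 - d / 2)) < 0)
      by (apply Hnear, Rabs_def1; lra).
    lra.
  - intros Hend x Hx; apply Rnot_le_lt; intros Hneg.
    (* a nonpositive value between two nonnegative ones makes the slope
       nonpositive at some point and nonnegative at a later one *)
    destruct (gap_mvt mu 0 x) as [c [Hc Ec]]; [lra|lra|].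
    destruct (gap_mvt mu x (PI / 4)) as [d [Hd Ed]]; [lra|lra|].
    rewrite gap_0 in Ec.
    assert (Hdec := slope_decreasing mu c d ltac:(lra) ltac:(lra)).
    destruct (acute_pos c) as [Hsc _]; [lra|].
    destruct (acute_pos d) as [Hsd _]; [lra|].
    assert (Pc : 0 < sin c ^ 2 * (x - 0))
      by (apply Rmult_lt_0_compat; [apply pow_lt|]; lra).
    assert (Pd : 0 < sin d ^ 2 * (PI / 4 - x))
      by (apply Rmult_lt_0_compat; [apply pow_lt|]; lra).
    assert (slope mu c <= 0) by (apply Rnot_lt_le; intros Hs; nra).
    assert (0 <= slope mu d) by (apply Rnot_lt_le; intros Hs; nra).
    lra.
Qed.

Lemma gap_neg_iff (mu : R) :
  (forall x, 0 < x < PI / 4 -> gap mu x < 0) <-> 1 / 4 <= mu.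
Proof.
  assert (HPI := PI_RGT_0); split.
  - intros H; apply Rnot_lt_le; intros Hmu.
    destruct (continuity_pt_neg_near
                (fun x => - (1 - 2 * mu + cos x / (1 + cos x) - / cos x)) 0)
      as [d [Hd Hnear]].
    + apply derivable_continuous_pt; eexists; apply is_derive_Reals.
      auto_derive; [rewrite cos_0; repeat split; lra | reflexivity].
    + rewrite cos_0; lra.
    + assert (Hmin := Rmin_l (PI / 8) d); assert (Hmin' := Rmin_r (PI / 8) d).
      assert (Hpos : 0 < Rmin (PI / 8) d) by (apply Rmin_glb_lt; lra).
      set (x := Rmin (PI / 8) d) in *.
      destruct (gap_mvt mu 0 x) as [c [Hc Ec]]; [lra|lra|].
      rewrite gap_0 in Ec.
      specialize (H x ltac:(lra)).
      assert (Hc' := Hnear c ltac:(apply Rabs_def1; lra)); cbv beta in Hc'.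
      assert (Hlow := slope_lower mu c ltac:(lra)).
      destruct (acute_pos c) as [Hs _]; [lra|].
      assert (0 < sin c ^ 2 * slope mu c * (x - 0))
        by (repeat apply Rmult_lt_0_compat; try apply pow_lt; lra).
      lra.
  - intros Hmu x Hx.
    destruct (gap_mvt mu 0 x) as [c [Hc Ec]]; [lra|lra|].
    rewrite gap_0 in Ec.
    assert (Hup := slope_upper mu c ltac:(lra)).
    destruct (acute_pos c) as [Hs _]; [lra|].
    assert (0 < sin c ^ 2 * - slope mu c * (x - 0))
      by (repeat apply Rmult_lt_0_compat; try apply pow_lt; lra).
    lra.
Qed.

Lemma gap_PI4_nonneg_iff (mu : R) :
  0 <= gap mu (PI / 4) <->
  mu <= (PI - 2 * sqrt 2) / (sqrt 2 * PI - 2 * sqrt 2).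
Proof.
  assert (Hr : 0 < sqrt 2) by (apply sqrt_lt_R0; lra).
  assert (Hr2 : sqrt 2 * sqrt 2 = 2) by (apply sqrt_sqrt; lra).
  assert (HPI : 2 < PI) by (generalize PI2_1; lra).
  assert (Hd : 0 < sqrt 2 * PI - 2 * sqrt 2) by nra.
  assert (E : gap mu (PI / 4) =
    (sqrt 2 * PI - 2 * sqrt 2) / (4 * sqrt 2) *
    ((PI - 2 * sqrt 2) / (sqrt 2 * PI - 2 * sqrt 2) - mu)).
  { unfold gap; rewrite sin_PI4, cos_PI4.
    assert (Hhalf : 1 / sqrt 2 * (1 / sqrt 2) = 1 / 2).
    { replace (1 / sqrt 2 * (1 / sqrt 2)) with (1 / (sqrt 2 * sqrt 2))
        by (field; lra).
      now rewrite Hr2. }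
    rewrite Rmult_minus_distr_l, Hhalf; field; lra. }
  assert (Hk : 0 < (sqrt 2 * PI - 2 * sqrt 2) / (4 * sqrt 2))
    by (apply Rdiv_lt_0_compat; lra).
  rewrite E; split; intros H; nra.
Qed.

(** * Trigonometric parametrisation of the means *)

Lemma means_swap (a b : R) :
  contraharmonic_mean b a = contraharmonic_mean a b /\
  root_square_mean b a = root_square_mean a b /\
  second_seiffert_mean b a = second_seiffert_mean a b.
Proof.
  unfold contraharmonic_mean, root_square_mean, second_seiffert_mean.
  repeat split; [now rewrite !(Rplus_comm (b ^ _)), (Rplus_comm b)
                |now rewrite (Rplus_comm (b ^ _))|].
  replace ((b - a) / (b + a)) with (- ((a - b) / (a + b)))
    by (rewrite (Rplus_comm b); unfold Rdiv; ring).
  rewrite atan_opp.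
  replace (2 * - atan ((a - b) / (a + b)))
    with (- (2 * atan ((a - b) / (a + b)))) by ring.
  unfold Rdiv; rewrite Rinv_opp; ring.
Qed.

Lemma means_gap (mu u x : R) : 0 < u -> 0 < x < PI / 2 ->
  let a := u * (1 + tan x) in let b := u * (1 - tan x) in
  root_square_mean a b -
    (mu * contraharmonic_mean a b + (1 - mu) * second_seiffert_mean a b)
  = u / (x * cos x ^ 2) * gap mu x.
Proof.
  intros Hu Hx a b.
  destruct (acute_pos x Hx) as [Hs Hcos].
  assert (Hsec : 1 + tan x ^ 2 = / cos x ^ 2).
  { unfold tan; apply Rmult_eq_reg_r with (cos x ^ 2);
      [|apply pow_nonzero; lra].
    replace ((1 + (sin x / cos x) ^ 2) * cos x ^ 2)
      with (sin x * sin x + cos x * cos x) by (field; lra).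
    rewrite sin_sqr; field; lra. }
  assert (ES : root_square_mean a b = u / cos x).
  { unfold root_square_mean, a, b.
    replace (((u * (1 + tan x)) ^ 2 + (u * (1 - tan x)) ^ 2) / 2)
      with (u ^ 2 * (1 + tan x ^ 2)) by field.
    rewrite Hsec.
    replace (u ^ 2 * / cos x ^ 2) with ((u / cos x) ^ 2) by (field; lra).
    apply sqrt_pow2, Rlt_le, Rdiv_lt_0_compat; lra. }
  assert (EC : contraharmonic_mean a b = u / cos x ^ 2).
  { unfold contraharmonic_mean, a, b.
    replace (((u * (1 + tan x)) ^ 2 + (u * (1 - tan x)) ^ 2) /
             (u * (1 + tan x) + u * (1 - tan x)))
      with (u * (1 + tan x ^ 2)) by (field; lra).
    now rewrite Hsec. }
  assert (ET : second_seiffert_mean a b = u * tan x / x).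
  { unfold second_seiffert_mean, a, b.
    replace ((u * (1 + tan x) - u * (1 - tan x)) /
             (u * (1 + tan x) + u * (1 - tan x))) with (tan x) by (field; lra).
    rewrite atan_tan by lra; field; lra. }
  rewrite ES, EC, ET; unfold tan, gap; field; lra.
Qed.

Lemma tan_param (a b : R) : 0 < b < a ->
  exists u x, 0 < u /\ 0 < x < PI / 4 /\
    a = u * (1 + tan x) /\ b = u * (1 - tan x).
Proof.
  intros Hab; exists ((a + b) / 2), (atan ((a - b) / (a + b))).
  rewrite tan_atan.
  split; [lra|]; split; [|split; field; lra].
  rewrite <- atan_0, <- atan_1; split; apply atan_increasing.
  - apply Rdiv_lt_0_compat; lra.
  - apply Rmult_lt_reg_r with (a + b); [lra|].
    unfold Rdiv; rewrite Rmult_assoc, Rinv_l; lra.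
Qed.

Lemma gap_sign_means (mu u x : R) : 0 < u -> 0 < x < PI / 2 ->
  let a := u * (1 + tan x) in let b := u * (1 - tan x) in
  let M := mu * contraharmonic_mean a b + (1 - mu) * second_seiffert_mean a b in
  (M < root_square_mean a b <-> 0 < gap mu x) /\
  (root_square_mean a b < M <-> gap mu x < 0).
Proof.
  intros Hu Hx a b M.
  assert (E := means_gap mu u x Hu Hx); cbv zeta in E; fold a b in E; fold M in E.
  destruct (acute_pos x Hx) as [_ Hcos].
  assert (Hk : 0 < u / (x * cos x ^ 2)).
  { apply Rdiv_lt_0_compat; [lra|].
    apply Rmult_lt_0_compat; [|apply pow_lt]; lra. }
  split; split; intros H; nra.
Qed.

(** The means are symmetric, so only [b < a] matters, and homogeneous, so the
    pairs of scale [u = 1] already determine the sign of the gap. *)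
Lemma double_inequality_gap (alpha beta : R) :
  (forall a b : R, 0 < a -> 0 < b -> a <> b ->
     alpha * contraharmonic_mean a b + (1 - alpha) * second_seiffert_mean a b
       < root_square_mean a b
     /\
     root_square_mean a b
       < beta * contraharmonic_mean a b + (1 - beta) * second_seiffert_mean a b)
  <->
  (forall x, 0 < x < PI / 4 -> 0 < gap alpha x /\ gap beta x < 0).
Proof.
  assert (HPI := PI_RGT_0); split.
  - intros H x Hx.
    assert (Ht : 0 < tan x < 1).
    { rewrite <- tan_0, <- tan_PI4; split; apply tan_increasing; lra. }
    specialize (H (1 * (1 + tan x)) (1 * (1 - tan x))
                  ltac:(lra) ltac:(lra) ltac:(lra)).
    assert (Ia := gap_sign_means alpha 1 x ltac:(lra) ltac:(lra)).
    assert (Ib := gap_sign_means beta 1 x ltac:(lra) ltac:(lra)).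
    split; [now apply (proj1 Ia) | now apply (proj2 Ib)].
  - intros H.
    assert (Hlt : forall a b, 0 < b < a ->
      alpha * contraharmonic_mean a b + (1 - alpha) * second_seiffert_mean a b
        < root_square_mean a b /\
      root_square_mean a b
        < beta * contraharmonic_mean a b + (1 - beta) * second_seiffert_mean a b).
    { intros a b Hab.
      destruct (tan_param a b Hab) as [u [x [Hu [Hx [-> ->]]]]].
      assert (Ia := gap_sign_means alpha u x Hu ltac:(lra)).
      assert (Ib := gap_sign_means beta u x Hu ltac:(lra)).
      split; [now apply (proj1 Ia), H | now apply (proj2 Ib), H]. }
    intros a b Ha Hb Hne.
    destruct (Rdichotomy a b Hne) as [Hab | Hab]; [|apply Hlt; lra].
    destruct (means_swap b a) as [-> [-> ->]]; apply Hlt; lra.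
Qed.

Theorem theorem5p2 (alpha beta : R) :
  (forall a b : R, 0 < a -> 0 < b -> a <> b ->
     alpha * contraharmonic_mean a b + (1 - alpha) * second_seiffert_mean a b
       < root_square_mean a b
     /\
     root_square_mean a b
       < beta * contraharmonic_mean a b + (1 - beta) * second_seiffert_mean a b)
  <->
  (alpha <= (PI - 2 * sqrt 2) / (sqrt 2 * PI - 2 * sqrt 2) /\ beta >= 1 / 4).
Proof.
  rewrite double_inequality_gap, <- gap_PI4_nonneg_iff, <- gap_pos_iff.
  assert (Hbeta := gap_neg_iff beta).
  split.
  - intros H; split; [intros x Hx; now apply H|].
    apply Rle_ge, Hbeta; intros x Hx; now apply H.
  - intros [Hpos Hge] x Hx; split; [now apply Hpos|].
    apply Hbeta; [lra | exact Hx].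
Qed.
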